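(* Let $A,B,Q$ be posets and let $f:A\to Q$ and $g:B\to Q$ be order compressing maps such that $(f^{-1}(\beta))^*=(g^{-1}(\beta))^*$ for all $\beta\in Q$. Then for every $\alpha\in Q$, if $a\in f^{-1}(\alpha)$ and $b\in g^{-1}(\alpha)$ satisfy $\mathcal{G}(f^{-1}(\alpha)-a_\leq)=\mathcal{G}(g^{-1}(\alpha)-b_\leq)$, then $\mathcal{G}(A-a_\leq)=\mathcal{G}(B-b_\leq)$.
   Context: Poset game: played on a poset $P$ (posets are assumed such that the game is well-founded, e.g. finite); a move consists of choosing $p\in P$ and replacing $P$ by $P-p_\leq:=P\setminus\{p' : p\leq p'\}$; normal play. The nimber is defined by $\mathcal{G}(\emptyset)=0$ and $\mathcal{G}(P)=\mathrm{mex}(P^* )$, where $P^*=\{\mathcal{G}(P-p_\leq):p\in P\}$ is the option value set and mex is the least nonnegative integer not in the set. A function $f:P\to Q$ between posets is order compressing if for all $x,y\in P$: $f(x)=f(y)=q$ holds if and only if for every $z\in P$: (i) if $z<_P x$ and $z<_P y$ then $f(z)\leq_Q q$; (ii) if $z\not<_P x$ and $z\not<_P y$ then $f(z)\not<_Q q$; (iii) if exactly one of $z<_P x$, $z<_P y$ holds, then $f(z)=q$. For $q\in Q$, $f^{-1}(q)$ denotes the subposet of $P$ (induced order) on the preimage of $q$. *)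

(* Defs.v *)
From HB Require Import structures.
From mathcomp Require Import all_boot all_order.
From mathcomp Require Import all_classical.
From Stdlib Require Import Relation_Operators.

Set Implicit Arguments.
Unset Strict Implicit.
Unset Printing Implicit Defensive.

Import Order.TTheory.
Local Open Scope classical_set_scope.
Local Open Scope order_scope.

Definition is_mex (U : set nat) (n : nat) : Prop :=
  ~ U n /\ forall m : nat, (m < n)%N -> U m.

(* Junk value 0 when U is the set of all natural numbers. *)
Definition mex (U : set nat) : nat := xget 0 (is_mex U).

Section PosetGame.
Context {d : Order.disp_t} {T : porderType d}.
Implicit Types (P : set T) (p : T).

(* A subposet of T (with the induced order) is represented by its carrier
   P : set T; [remove P p] is P - p_<=. *)
Definition remove P p : set T := [set x | P x /\ ~~ (p <= x)].

Definition move (P' P : set T) : Prop := exists2 p, P p & P' = remove P p.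

Definition well_founded_game P : Prop := Acc move P.

Lemma move_remove P p : P p -> move (remove P p) P.
Proof. by exists p. Qed.

Fixpoint nimber_rec P (wfP : well_founded_game P) {struct wfP} : nat :=
  mex [set n | exists (p : T) (Pp : P p),
                 n = nimber_rec (Acc_inv wfP (move_remove Pp))].

(* Junk value 0 when the game on P is not well-founded; see [nimberE]. *)
Definition nimber P : nat :=
  if pselect (well_founded_game P) is left wfP then nimber_rec wfP else 0%N.

Definition option_values P : set nat :=
  [set nimber (remove P p) | p in P].

Lemma nimber_recE P (wfP : well_founded_game P) : nimber_rec wfP = nimber P.
Proof.
rewrite /nimber; case: pselect => // wfP'.
by rewrite (Prop_irrelevance wfP wfP').
Qed.

Lemma nimberE P : well_founded_game P -> nimber P = mex (option_values P).
Proof.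
move=> wfP; rewrite -(nimber_recE wfP); case: wfP => wfP /=.
congr mex; apply/seteqP; split=> n /=.
  by move=> [p [Pp ->]]; exists p; rewrite ?nimber_recE.
by move=> [p Pp <-]; exists p, Pp; rewrite nimber_recE.
Qed.

Definition position_of : set T -> set T -> Prop := clos_refl_trans _ move.

(* For infinite posets well-foundedness does not ensure that the least
   nonnegative integer outside the option value set exists (an infinite
   ascending chain has all of nat as option values); nimbers are integers
   exactly when it exists at every position. *)
Definition has_nimbers P : Prop :=
  well_founded_game P /\
  forall P', position_of P' P -> exists n, ~ option_values P' n.

End PosetGame.

Lemma finite_has_nimbers {d : Order.disp_t} {T : finPOrderType d} (P : set T) :
  has_nimbers P.
Proof.
split.
  suff wf n (S : {set T}) : (#|S| < n)%N -> well_founded_game [set` S].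
    have -> : P = [set` [set x | x \in P]%SET].
      by apply/seteqP; split=> x /=; rewrite inE => Px; [rewrite inE|rewrite inE in Px].
    exact: (wf _ _ (ltnSn _)).
  elim: n S => [S|n IH S]; first by rewrite ltn0.
  rewrite ltnS => leSn; constructor=> _ [p /= Sp ->].
  have -> : remove [set` S] p = [set` [set x in S | ~~ (p <= x)%O]%SET].
    by apply/seteqP; split=> x /=; rewrite inE => /andP.
  apply: IH; apply: leq_trans leSn; apply: proper_card.
  apply/properP; split; first by apply/fintype.subsetP => x; rewrite inE => /andP[].
  by exists p; rewrite // inE lexx andbF.
move=> P' _; apply/existsNP => allP'.
pose s := [seq nimber (remove P' p) | p <- enum T].
have [p _ /esym sp] := allP' (\max_(i <- s) i).+1.
have : (\max_(i <- s) i).+1 \in s by rewrite sp; apply/mapP; exists p; rewrite ?mem_enum.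
by move=> /(@leq_bigmax_seq _ _ xpredT id)-/(_ isT); rewrite ltnn.
Qed.

Section OrderCompressing.
Context {dP dQ : Order.disp_t} {P : porderType dP} {Q : porderType dQ}.

Definition compressing_conditions (f : P -> Q) (x y : P) (q : Q) : Prop :=
  forall z : P,
    [/\ z < x /\ z < y -> f z <= q,
        ~ z < x /\ ~ z < y -> ~ f z < q &
        (z < x) (+) (z < y) -> f z = q].

(* The conditions are imposed on x, y and q whenever f x = f y = q.  They are
   not required to characterize the equality f x = f y = q: on a well-founded
   poset that biconditional holds only for constant maps (it fails for the
   identity of a two-element chain), see [order_compressing_iff_constant].  By
   [order_compressing_iffW], results on [order_compressing] maps also hold
   for maps satisfying the biconditional. *)
Definition order_compressing (f : P -> Q) : Prop :=
  forall (x y : P) (q : Q), f x = q /\ f y = q -> compressing_conditions f x y q.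

Definition order_compressing_iff (f : P -> Q) : Prop :=
  forall (x y : P) (q : Q), f x = q /\ f y = q <-> compressing_conditions f x y q.

Lemma order_compressing_iffW (f : P -> Q) :
  order_compressing_iff f -> order_compressing f.
Proof. by move=> H x y q /H. Qed.

Lemma order_compressing_iff_constant (f : P -> Q) :
  well_founded (fun x y : P => x < y) ->
  order_compressing_iff f -> forall x y : P, f x = f y.
Proof.
move=> wf H.
have mini (E : set P) x : E x -> exists2 m, E m & forall z, z < m -> ~ E z.
  elim: (wf x) => {}x _ IH Ex.
  have [[z [zx Ez]]|no] := pselect (exists z, z < x /\ E z); first exact: IH Ez.
  by exists x => // z zx Ez; apply: no; exists z.
suff C (x : P) : exists2 x0, (forall z, ~ z < x0) & forall y, f y = f x0.
  by move=> x y; have [x0 _ fx0] := C x; rewrite !fx0.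
have [x0 _ min0] := mini setT x I.
exists x0 => [z /min0 []//|y]; apply: contrapT => fy.
have [m fm minm] := mini (fun z => f z <> f x0) y fy.
apply: fm; suff /H[] : compressing_conditions f x0 m (f x0) by [].
move=> z; have zx0 : z < x0 = false by apply/negP => /min0 [].
split; rewrite zx0.
- by case.
- move=> _ fz.
  have [_ min_z _] := (H x0 x0 (f x0)).1 (conj erefl erefl) z.
  by apply: min_z fz; rewrite zx0; split.
- by move=> /minm /contrapT.
Qed.

End OrderCompressing.

(* Main.v *)
(** An order compressing map makes its domain the lexicographic sum of its
    fibers: [x <= y] iff [f x < f y], or [f x = f y] and [x <= y].  A move at
    [a] therefore empties all fibers above [f a], is a move in the fiber of
    [f a], and leaves the other fibers alone.  Relate positions [X] of [A] and
    [Y] of [B] when over each point of [Q] either both fibers are intact, or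
    they have the same nimber and all fibers above are empty.  Every move from
    a related pair is answered by restoring the relation: in the other
    component if the nimber of the fiber decreased or the fiber was intact, and
    by reverting the nimber in the same component if it increased.  Hence
    related positions have the same nimber.

    Since positions may be infinite, the argument also needs the fibers to have
    integer nimbers; this is [has_nimbers_fiber], where the part of [A] at or
    below a fiber is a position of [A] and an ordinal sum with the fiber on
    top. *)

Require Import Defs.
From mathcomp Require Import all_boot all_order.
From mathcomp Require Import all_classical.
From Stdlib Require Import Relation_Operators Operators_Properties.
From Stdlib Require Import Transitive_Closure.

Set Implicit Arguments.
Unset Strict Implicit.
Unset Printing Implicit Defensive.

Import Order.TTheory.
Local Open Scope order_scope.
Local Open Scope classical_set_scope.

(** * Nimbers and positions of possibly infinite posets *)

Section Nimbers.
Context {d : Order.disp_t} {T : porderType d}.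
Implicit Types (P U : set T) (p : T).

Lemma exists_is_mex (U : set nat) n : ~ U n -> exists m, is_mex U m.
Proof.
move=> Un; have exU : exists m, `[< ~ U m >] by exists n; apply/asboolP.
case: (ex_minnP exU) => m /asboolP Um minm; exists m; split=> // k km.
apply: contrapT => /asboolP/minm; by rewrite leqNgt km.
Qed.

(** The omitted option value supplied by [has_nimbers] yields a least one, so [xget] does not fall
    back on its default 0. *)
Lemma nimber_is_mex P : has_nimbers P -> is_mex (option_values P) (nimber P).
Proof.
move=> [wfP /(_ P (rt_refl _ _ _))[n /exists_is_mex[m mexm]]].
by rewrite nimberE //; apply: (xgetPex 0%N); exists m.
Qed.

Lemma nimber_remove_neq P p :
  has_nimbers P -> P p -> nimber (remove P p) <> nimber P.
Proof. by move=> /nimber_is_mex[nP _] Pp eqP; apply: nP; exists p. Qed.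

Lemma lt_nimber P n : has_nimbers P -> (n < nimber P)%N ->
  exists2 p, P p & nimber (remove P p) = n.
Proof. by move=> /nimber_is_mex[_ H] /H. Qed.

Lemma has_nimbers_position P P' :
  has_nimbers P -> position_of P' P -> has_nimbers P'.
Proof.
move=> [wfP nimP] P'P; split; last first.
  by move=> P'' P''P'; apply: nimP; apply: rt_trans P''P' P'P.
elim: P'P wfP {nimP} => [P1 P2 mv [H]|//|P1 P2 P3 _ IH1 _ IH2 /IH2/IH1//].
exact: H.
Qed.

Lemma has_nimbers_remove P p : has_nimbers P -> P p -> has_nimbers (remove P p).
Proof.
move=> nimP Pp; apply: has_nimbers_position nimP _.
exact/rt_step/move_remove.
Qed.

Lemma has_nimbers_intro P :
  (forall p, P p -> has_nimbers (remove P p)) ->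
  (exists n, ~ option_values P n) -> has_nimbers P.
Proof.
move=> nimP exn; split; first by constructor=> _ [p Pp ->]; case: (nimP p Pp).
(* Splitting off the first move of the play: [P'] is [P] itself or a position of an option of
   [P]. *)
move=> P' P'P; have {P'P} P'P := clos_rt_rtn1 _ _ _ _ P'P.
case: P / P'P exn nimP => // _ P [p Pp ->] P'P _ nimP.
exact: (nimP p Pp).2 (clos_rtn1_rt _ _ _ _ P'P).
Qed.

Lemma has_nimbers0 : has_nimbers (set0 : set T).
Proof. by apply: has_nimbers_intro => //; exists 0%N => -[]. Qed.

Lemma nimber0 : nimber (set0 : set T) = 0%N.
Proof.
by have [//|/(lt_nimber has_nimbers0)[]] := posnP (nimber (set0 : set T)).
Qed.

Lemma remove_setU P U p : remove (P `|` U) p = remove P p `|` remove U p.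
Proof.
apply/seteqP; split=> x; first by case=> -[Px|Ux] px; [left|right]; split.
by case=> -[Px px]; split=> //; [left|right].
Qed.

Lemma remove_id P p : (forall x, P x -> ~~ (p <= x)) -> remove P p = P.
Proof. by move=> H; apply/seteqP; split=> x /=; [case|split; auto]. Qed.

Lemma remove_eq0 P p : (forall x, P x -> p <= x) -> remove P p = set0.
Proof. by move=> H; apply/seteqP; split=> x //= -[/H ->]. Qed.

(** Moves at points of the up-set [U] delete only points of [U]; by well-foundedness such play ends,
    and then [U] is exhausted. *)
Lemma position_setD P U : well_founded_game P ->
  (forall x y, U x -> x <= y -> U y) -> position_of (P `\` U) P.
Proof.
move=> + upU; elim=> {}P _ IH.
have [[p [Pp Up]]|noU] := pselect (exists p, P p /\ U p); last first.
  suff -> : P `\` U = P by apply: rt_refl.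
  apply/seteqP; split=> x; first by case.
  by move=> Px; split=> // Ux; apply: noU; exists x.
apply: rt_trans (rt_step _ _ _ _ (move_remove Pp)).
suff -> : P `\` U = remove P p `\` U by apply/IH/move_remove.
apply/seteqP; split=> x; last by case=> -[].
move=> [Px nUx]; split=> //; split=> //.
by apply/negP => px; apply: nUx; apply: upU px.
Qed.

End Nimbers.

(** * Equality of nimbers by answering moves *)

(* The second disjunct is a reversible move: after [p], the answer [p']
   in the same component restores the relation. *)
Definition answers {dA dB : Order.disp_t} {A : porderType dA}
    {B : porderType dB} (R : set A -> set B -> Prop) (X : set A) (Y : set B) :=
  forall p, X p ->
    (exists2 q, Y q & R (remove X p) (remove Y q)) \/
    (exists2 p', remove X p p' & R (remove (remove X p) p') Y).

(** No option of [X] has the nimber of [Y]: a direct answer gives it the nimber of an option of [Y],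
    a reverting one gives it an option with the nimber of [Y]. The same holds with the sides
    exchanged, whereas the smaller of two distinct nimbers would occur among the options of the
    other position. *)
Lemma eq_nimber {dA dB : Order.disp_t} {A : porderType dA} {B : porderType dB}
    (R : set A -> set B -> Prop) :
  (forall X Y, R X Y -> has_nimbers X /\ has_nimbers Y) ->
  (forall X Y, R X Y -> answers R X Y) ->
  (forall X Y, R X Y -> answers (fun Y X => R X Y) Y X) ->
  forall X Y, R X Y -> nimber X = nimber Y.
Proof.
move=> nimR ansX ansY X Y RXY; have [[wfX _] [wfY _]] := nimR _ _ RXY.
(* A reverting answer leads two moves down, hence induction along the transitive closure. *)
elim: {wfX}(Acc_clos_trans _ _ _ wfX) Y RXY wfY => {}X _ IHX Y RXY.
move=> wfY; elim: {wfY}(Acc_clos_trans _ _ _ wfY) RXY => {}Y accY IHY RXY.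
have [nimX nimY] := nimR _ _ RXY.
have nX p : X p -> nimber (remove X p) <> nimber Y.
  move=> Xp; have [[q Yq RXY']|[p' Xp' RXY']] := ansX _ _ RXY p Xp.
    rewrite (IHX _ _ _ RXY'); first exact: nimber_remove_neq.
      exact/t_step/move_remove.
    by case: (nimR _ _ RXY') => _ [].
  rewrite -(IHX _ _ _ RXY' nimY.1); last first.
    by apply: t_trans; apply/t_step/move_remove; first exact: Xp'.
  exact: nesym (nimber_remove_neq (has_nimbers_remove nimX Xp) Xp').
have nY q : Y q -> nimber (remove Y q) <> nimber X.
  move=> Yq; have [[p Xp RXY']|[q' Yq' RXY']] := ansY _ _ RXY q Yq.
    rewrite -(IHX _ _ _ RXY'); first exact: nimber_remove_neq.
      exact/t_step/move_remove.
    by case: (nimR _ _ RXY') => _ [].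
  rewrite (IHY _ _ RXY'); last first.
    by apply: t_trans; apply/t_step/move_remove; first exact: Yq'.
  exact: nesym (nimber_remove_neq (has_nimbers_remove nimY Yq) Yq').
have [/(lt_nimber nimY)[q /nY]|/(lt_nimber nimX)[p /nX]|//] :=
  ltngtP (nimber X) (nimber Y); by [].
Qed.

Lemma game_ind {d : Order.disp_t} {T : porderType d} (K : set T -> Prop) :
  (forall P, (forall p, P p -> K (remove P p)) -> K P) ->
  forall P, well_founded_game P -> K P.
Proof.
move=> H P; elim=> {}P _ IH; apply: H => p Pp.
exact: IH (move_remove Pp).
Qed.

(** * Ordinal sums with a fixed bottom *)

Section OrdinalSum.
Context {d : Order.disp_t} {T : porderType d} (D : set T).
Implicit Types (F : set T).

Definition below_all F := forall x y, D x -> F y -> x < y.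

Lemma below_all_remove F p : below_all F -> below_all (remove F p).
Proof. by move=> DF x y Dx [Fy _]; apply: DF. Qed.

Lemma remove_sum_top F p : below_all F -> F p ->
  remove (D `|` F) p = D `|` remove F p.
Proof.
move=> DF Fp; rewrite remove_setU remove_id // => x Dx.
by rewrite lt_geF // DF.
Qed.

Lemma remove_sum_bottom F p : below_all F -> D p ->
  remove (D `|` F) p = remove D p.
Proof.
move=> DF Dp; rewrite remove_setU (@remove_eq0 _ _ F) ?setU0 // => x Fx.
by rewrite ltW // DF.
Qed.

Lemma has_nimbers_remove_sum F p : below_all F -> F p ->
  has_nimbers (D `|` F) -> has_nimbers (D `|` remove F p).
Proof.
move=> DF Fp nimDF; rewrite -(remove_sum_top DF Fp).
by apply: has_nimbers_remove nimDF _; right.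
Qed.

(** The case [X = Y] arises after a move in [D], which deletes either top entirely. *)
Definition similar_sums (X Y : set T) :=
  [/\ has_nimbers X, has_nimbers Y &
    X = Y \/ exists F F', [/\ X = D `|` F, Y = D `|` F' &
      [/\ below_all F, below_all F', has_nimbers F, has_nimbers F' &
         nimber F = nimber F']]].

Lemma similar_sums_sym X Y : similar_sums X Y -> similar_sums Y X.
Proof.
move=> [nX nY XY]; split=> //; case: XY => [->|]; first by left.
by move=> [F [F' [eX eY [? ? ? ? eFF']]]]; right; exists F', F; split.
Qed.

(* Pitfall: [//] diverges on an open [has_nimbers] goal, splitting [Acc]. *)
Lemma similar_sums_answers X Y : similar_sums X Y -> answers similar_sums X Y.
Proof.
move=> [nimX nimY XY] p Xp; have nimXp := has_nimbers_remove nimX Xp.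
case: XY => [<-|[F [F' [eX eY [DF DF' nimF nimF' eFF']]]]].
  by left; exists p; [|split; [| |left]].
have [Dp|Fp] : D p \/ F p by rewrite eX in Xp.
  have Yp : Y p by rewrite eY; left.
  left; exists p; first by [].
  split; [done|exact: has_nimbers_remove|left].
  by rewrite eX eY !remove_sum_bottom.
have eXp : remove X p = D `|` remove F p by rewrite eX remove_sum_top.
have nimFp := has_nimbers_remove nimF Fp.
have DFp := @below_all_remove _ p DF.
have := nimber_remove_neq nimF Fp.
have [lt_p _|lt_p _|//] := ltngtP (nimber (remove F p)) (nimber F).
  rewrite eFF' in lt_p; have [q F'q eq] := lt_nimber nimF' lt_p.
  have Yq : Y q by rewrite eY; right.
  left; exists q; first by [].
  split; [done|exact: has_nimbers_remove|right].
  exists (remove F p), (remove F' q); split; first by [].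
    by rewrite eY remove_sum_top.
  split; [done|exact: below_all_remove|done|exact: has_nimbers_remove|done].
have [p' Fp' ep'] := lt_nimber nimFp lt_p.
have Xp' : remove X p p' by rewrite eXp; right.
right; exists p'; first by [].
split; [exact: has_nimbers_remove|done|right].
exists (remove (remove F p) p'), F'; split; [|done|].
  by rewrite eXp remove_sum_top.
split; [exact: below_all_remove|done|exact: has_nimbers_remove|done|].
by rewrite ep'.
Qed.

(** The colon principle: a move in one top to a lower nimber is copied in the other, and one to a
    higher nimber is reverted. *)
Lemma eq_nimber_sum F F' : below_all F -> below_all F' ->
  has_nimbers F -> has_nimbers F' ->
  has_nimbers (D `|` F) -> has_nimbers (D `|` F') ->
  nimber F = nimber F' -> nimber (D `|` F) = nimber (D `|` F').
Proof.
move=> DF DF' nimF nimF' nimDF nimDF' eFF'.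
apply: (@eq_nimber _ _ _ _ similar_sums).
- by move=> X Y [].
- exact: similar_sums_answers.
- move=> X Y /similar_sums_sym/similar_sums_answers ans p /ans[] [q Yq].
    by move=> /similar_sums_sym; left; exists q.
  by move=> /similar_sums_sym; right; exists q.
- by split; [| |right; exists F, F'].
Qed.

Lemma has_nimbers_top F : below_all F -> has_nimbers (D `|` F) -> has_nimbers F.
Proof.
move=> + nimDF; have [wfDF _] := nimDF; move: wfDF nimDF.
move eP : (D `|` F) => P wfP; move: P wfP F eP.
apply: game_ind => P IH F eP nimP DF.
have nimDFp x : F x -> has_nimbers (D `|` remove F x).
  by move=> Fx; apply: has_nimbers_remove_sum; rewrite ?eP.
have nimF x : F x -> has_nimbers (remove F x).
  move=> Fx; have Px : P x by rewrite -eP; right.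
  apply: (IH x Px); last exact: below_all_remove.
    by rewrite -eP remove_sum_top.
  exact: has_nimbers_remove.
apply: has_nimbers_intro; [exact: nimF|apply/existsNP => optF].
(* [phi n] is the nimber of [D `|` F'] for the options [F'] of [F] of nimber
   [n].  It is injective, so it exceeds the value [k] missing from the options
   of [D `|` F]; but then [k] is an option value of some [D `|` F'], all of
   which are also option values of [D `|` F]. *)
have {optF} /choice[s sF] n : exists x, F x /\ nimber (remove F x) = n.
  by have [x Fx ex] := optF n; exists x.
pose phi n := nimber (D `|` remove F (s n)).
have optDF x : F x -> option_values P (nimber (D `|` remove F x)).
  by move=> Fx; exists x; rewrite -eP; [right|rewrite remove_sum_top].
(* [remove F (s m)] has an option of nimber [n]. The sum of [D] with it has nimber [phi n] by
   [eq_nimber_sum] and is an option of the sum defining [phi m]. *)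
have phi_lt n m : (n < m)%N -> phi n <> phi m.
  move=> nm; have [[Fn en] [Fm em]] := (sF n, sF m).
  have [|y Fy ey] := @lt_nimber _ _ (remove F (s m)) n (nimF _ Fm).
    by rewrite em.
  have DFm := @below_all_remove _ (s m) DF.
  have Dy : (D `|` remove F (s m)) y by right.
  have := nimber_remove_neq (nimDFp _ Fm) Dy.
  rewrite (remove_sum_top DFm Fy) (eq_nimber_sum (F' := remove F (s n))).
  - by [].
  - exact: below_all_remove.
  - exact: below_all_remove.
  - exact: has_nimbers_remove (nimF _ Fm) Fy.
  - exact: nimF.
  - exact: has_nimbers_remove_sum (nimDFp _ Fm).
  - exact: nimDFp.
  - by rewrite ey en.
have phi_inj : injective phi.
  by move=> n m; case: (ltngtP n m) => // /phi_lt // + /esym.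
have [k optk] := nimP.2 P (rt_refl _ _ _).
have [n kn] : exists n, (k < phi n)%N.
  apply: contrapT => /forallNP phik.
  (* Otherwise [phi] would inject the [k+2] numbers up to [k+1] into the [k+1] numbers up to [k]. *)
  suff : (size (map phi (iota 0 k.+2)) <= size (iota 0 k.+1))%N.
    by rewrite size_map !size_iota ltnn.
  apply: uniq_leq_size; first by rewrite map_inj_uniq // iota_uniq.
  by move=> _ /mapP[n _ ->]; rewrite mem_iota /= ltnS leqNgt; apply/negP.
have [Fn en] := sF n.
have [y [Dy|Fy] ey] := lt_nimber (nimDFp _ Fn) kn; apply: optk.
  exists y; first by rewrite -eP; left.
  by rewrite -ey -eP !remove_sum_bottom //; apply: below_all_remove.
have DFn := @below_all_remove _ (s n) DF.
(* A single move in [F] reaches the same nimber as the two moves [s n] and [y]. *)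
have [Fm em] := sF (nimber (remove (remove F (s n)) y)).
suff <- : nimber (D `|` remove F (s (nimber (remove (remove F (s n)) y)))) = k.
  exact: optDF.
rewrite -ey (remove_sum_top DFn Fy); apply: eq_nimber_sum em.
- exact: below_all_remove.
- exact: below_all_remove.
- exact: nimF.
- exact: has_nimbers_remove (nimF _ Fn) Fy.
- exact: nimDFp.
- exact: has_nimbers_remove_sum (nimDFp _ Fn).
Qed.

End OrdinalSum.

(** * Fibers of an order compressing map *)

Section Fibers.
Context {dA dQ : Order.disp_t} {A : porderType dA} {Q : porderType dQ}.
Variable f : A -> Q.
Implicit Types (X Y : set A) (beta gamma : Q).

Definition fiber X beta : set A := X `&` f @^-1` [set beta].

(** The effect of moves in the fiber over [beta] on the other fibers. That fiber itself is left
    free, so that a move and its reversal compose to one change. *)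
Definition changes_at X X' beta :=
  X' `<=` X /\
  forall gamma, (beta < gamma -> fiber X' gamma = set0) /\
                (~~ (beta <= gamma) -> fiber X' gamma = fiber X gamma).

Lemma changes_at_trans X X' X'' beta :
  changes_at X X' beta -> changes_at X' X'' beta -> changes_at X X'' beta.
Proof.
move=> [sX' cX'] [sX'' cX'']; split=> [x /sX''/sX' //|gamma].
have [[a1 b1] [a2 b2]] := (cX' gamma, cX'' gamma).
by split=> H; [rewrite a2|rewrite b2 ?b1].
Qed.

Lemma changes_at_refl X beta :
  (forall gamma, beta < gamma -> fiber X gamma = set0) -> changes_at X X beta.
Proof. by move=> X0; split=> // gamma; split=> // /X0. Qed.

Hypothesis f_compressing : order_compressing f.

(** At the pair [y, y] the first compressing condition gives monotonicity; the second one gives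
    [compressing_reflect]. *)
Lemma compressing_homo x y : x <= y -> f x <= f y.
Proof.
rewrite le_eqVlt => /orP[/eqP->//|xy].
by have [H _ _] := f_compressing (conj (erefl (f y)) (erefl (f y))) x; apply: H.
Qed.

Lemma compressing_reflect x y : f x < f y -> x < y.
Proof.
move=> xy; apply/negPn/negP => /negP nxy.
have [_ H _] := f_compressing (conj (erefl (f y)) (erefl (f y))) x.
by apply: H xy.
Qed.

Lemma changes_at_remove X p : changes_at X (remove X p) (f p).
Proof.
split=> [x []//|gamma]; split=> H; apply/seteqP; split=> x //=.
- move=> [[Xx /negP px] fx]; apply: px.
  by apply/ltW/compressing_reflect; rewrite fx.
- by case=> -[].
- move=> [Xx fx]; split=> //; split=> //; apply: contra H => /compressing_homo.
  by rewrite fx.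
Qed.

Lemma fiber_remove X p beta : fiber (remove X p) beta = remove (fiber X beta) p.
Proof. by apply/seteqP; split=> x; [case=> -[]|case=> -[]]. Qed.

Lemma has_nimbers_fiber beta :
  has_nimbers [set: A] -> has_nimbers (fiber [set: A] beta).
Proof.
move=> nimA; pose D := [set x | f x < beta].
apply: (@has_nimbers_top _ _ D).
  by move=> x y Dx [_ fy]; apply: compressing_reflect; rewrite fy.
(* As [f] is monotone, the points deleted here form an up-set. *)
have -> : D `|` fiber [set: A] beta = [set: A] `\` [set x | ~~ (f x <= beta)].
  apply/seteqP; split=> x /=.
    by case=> [/ltW ->|[_ ->]]; split=> //; apply/negP; rewrite negbK.
  by case=> _ /negP; rewrite negbK le_eqVlt => /orP[/eqP|]; [right|left].
apply: (has_nimbers_position nimA); apply: position_setD; first exact: nimA.1.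
move=> x y /= + /compressing_homo xy; apply: contra; exact: le_trans.
Qed.

End Fibers.

(** * Matching positions of two posets over [Q] *)

Section Matching.
Context {dA dB dQ : Order.disp_t} {A : porderType dA} {B : porderType dB}
  {Q : porderType dQ}.
Implicit Types (f : A -> Q) (g : B -> Q) (X : set A) (Y : set B) (beta : Q).

Definition intact f g X Y beta :=
  fiber f X beta = fiber f [set: A] beta /\
  fiber g Y beta = fiber g [set: B] beta.

(** Reverting a move over [beta] leaves the fibers above empty in the component played in, so they
    have to be empty in both beforehand. *)
Definition balanced f g X Y beta :=
  [/\ has_nimbers (fiber f X beta), has_nimbers (fiber g Y beta),
      nimber (fiber f X beta) = nimber (fiber g Y beta) &
      forall gamma, beta < gamma ->
        fiber f X gamma = set0 /\ fiber g Y gamma = set0].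

Definition matching f g X Y :=
  [/\ has_nimbers X, has_nimbers Y &
      forall beta, intact f g X Y beta \/ balanced f g X Y beta].

(** Over [beta] the nimbers agree by assumption, and above it both sides are empty. All other fibers
    keep their state, and emptiness above them persists because positions only shrink. *)
Lemma matching_changes_at f g X Y X' Y' beta :
  (forall gamma, intact f g X Y gamma \/ balanced f g X Y gamma) ->
  has_nimbers X' -> has_nimbers Y' ->
  changes_at f X X' beta -> changes_at g Y Y' beta ->
  has_nimbers (fiber f X' beta) -> has_nimbers (fiber g Y' beta) ->
  nimber (fiber f X' beta) = nimber (fiber g Y' beta) ->
  matching f g X' Y'.
Proof.
move=> XY nimX' nimY' [sX cX] [sY cY] nimXb nimYb eb.
split; [done|done|move=> gamma].
have X0 c : beta < c -> fiber f X' c = set0 by case: (cX c).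
have Y0 c : beta < c -> fiber g Y' c = set0 by case: (cY c).
have [bc|nbc] := boolP (beta <= gamma).
  move: bc; rewrite le_eqVlt => /orP[/eqP<-|bc]; right.
    by split; [done|done|done|move=> c /[dup] /X0-> /Y0->].
  rewrite /balanced (X0 _ bc) (Y0 _ bc); split; try exact: has_nimbers0.
    by rewrite !nimber0.
  by move=> c /(lt_trans bc) bc'; rewrite X0 // Y0.
have [eX eY] := ((cX gamma).2 nbc, (cY gamma).2 nbc).
have [[iX iY]|[nX nY e0 XY0]] := XY gamma; first by left; rewrite /intact eX eY.
right; rewrite /balanced eX eY; split; [done|done|done|move=> c /XY0[Xc Yc]].
rewrite -!subset0 -{1}Xc -{1}Yc.
by split=> x [? ?]; split; [apply: sX| |apply: sY|].
Qed.

Lemma matching_answers f g :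
  order_compressing f -> order_compressing g ->
  has_nimbers [set: A] -> has_nimbers [set: B] ->
  (forall beta, option_values (fiber f [set: A] beta) =
                option_values (fiber g [set: B] beta)) ->
  forall X Y, matching f g X Y -> answers (matching f g) X Y.
Proof.
move=> fc gc nimA nimB eopt X Y [nimX nimY XY] p Xp.
have Xbp : fiber f X (f p) p by [].
have nimXp := has_nimbers_remove nimX Xp.
have cXp := changes_at_remove fc X p.
have answer q : g q = f p -> Y q ->
    has_nimbers (fiber f X (f p)) -> has_nimbers (fiber g Y (f p)) ->
    nimber (remove (fiber f X (f p)) p) = nimber (remove (fiber g Y (f p)) q) ->
    matching f g (remove X p) (remove Y q).
  move=> qp Yq nimXb nimYb epq; have cYq := changes_at_remove gc Y q.
  have Ybq : fiber g Y (f p) q by [].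
  have nimYq := has_nimbers_remove nimY Yq.
  rewrite qp in cYq; apply: (matching_changes_at XY nimXp nimYq cXp cYq).
  - by rewrite fiber_remove; apply: has_nimbers_remove nimXb Xbp.
  - by rewrite fiber_remove; apply: has_nimbers_remove nimYb Ybq.
  - by rewrite !fiber_remove.
have [[iX iY]|[nimXb nimYb eb XY0]] := XY (f p).
  (* Intact fibers have the same option values, so even a move raising the nimber has a direct
     answer. *)
  have : option_values (fiber f [set: A] (f p))
      (nimber (remove (fiber f X (f p)) p)).
    by exists p; rewrite -iX.
  rewrite eopt -iY => -[q [Yq qp] eq]; left; exists q; first by [].
  apply: answer qp Yq _ _ (esym eq).
    by rewrite iX; apply: has_nimbers_fiber.
  by rewrite iY; apply: has_nimbers_fiber.
have nimXbp := has_nimbers_remove nimXb Xbp.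
have := nimber_remove_neq nimXb Xbp.
have [lt_p _|lt_p _|//] :=
  ltngtP (nimber (remove (fiber f X (f p)) p)) (nimber (fiber f X (f p))).
  rewrite eb in lt_p; have [q [Yq qp] eq] := lt_nimber nimYb lt_p.
  by left; exists q; [|apply: answer (esym eq)].
have [p' Xbp' ep'] := lt_nimber nimXbp lt_p.
have Xp' : remove X p p' by case: Xbp' => -[].
have fp' : f p' = f p by case: Xbp' => -[].
have cXp' := changes_at_remove fc (remove X p) p'; rewrite fp' in cXp'.
right; exists p'; first by [].
apply: matching_changes_at XY _ nimY (changes_at_trans cXp cXp') _ _ nimYb _.
- exact: has_nimbers_remove nimXp Xp'.
(* [Y] stays put, yet counts as changed at [f p] because its fibers above are already empty. *)
- by apply: changes_at_refl => c /XY0[].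
- by rewrite !fiber_remove; apply: has_nimbers_remove nimXbp Xbp'.
- by rewrite !fiber_remove ep'.
Qed.

End Matching.

Lemma matching_sym {dA dB dQ : Order.disp_t} {A : porderType dA}
    {B : porderType dB} {Q : porderType dQ} (f : A -> Q) (g : B -> Q) X Y :
  matching f g X Y -> matching g f Y X.
Proof.
move=> [nX nY XY]; split; [done|done|move=> beta].
have [[iX iY]|[nXb nYb eb XY0]] := XY beta; [by left|right].
by split; [done|done|done|move=> c /XY0[]].
Qed.

Theorem theorem4
  (dA dB dQ : Order.disp_t)
  (A : porderType dA) (B : porderType dB) (Q : porderType dQ)
  (nimbersA : has_nimbers [set: A]) (nimbersB : has_nimbers [set: B])
  (f : A -> Q) (g : B -> Q)
  (f_compressing : order_compressing f) (g_compressing : order_compressing g)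
  (same_option_values : forall beta : Q,
     option_values (f @^-1` [set beta]) = option_values (g @^-1` [set beta])) :
  forall (alpha : Q) (a : A) (b : B),
    (f @^-1` [set alpha]) a -> (g @^-1` [set alpha]) b ->
    nimber (remove (f @^-1` [set alpha]) a) =
      nimber (remove (g @^-1` [set alpha]) b) ->
    nimber (remove [set: A] a) = nimber (remove [set: B] b).
Proof.
have fiberT d1 (S : porderType d1) (h : S -> Q) beta :
    fiber h [set: S] beta = h @^-1` [set beta] by rewrite /fiber setTI.
have eopt beta : option_values (fiber f [set: A] beta) =
    option_values (fiber g [set: B] beta) by rewrite !fiberT.
move=> alpha a b fa gb eab.
apply: (@eq_nimber _ _ _ _ (matching f g)).
- by move=> X Y [].
- exact: matching_answers.
- move=> X Y /matching_sym/matching_answers ans p Yp.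
  have [||||beta|[q Xq /matching_sym m]|[q Yq /matching_sym m]] :=
      ans _ _ _ _ _ p Yp.
  + exact: g_compressing.
  + exact: f_compressing.
  + exact: nimbersB.
  + exact: nimbersA.
  + by rewrite eopt.
  + by left; exists q.
  + by right; exists q.
- have cA := changes_at_remove f_compressing [set: A] a.
  have cB := changes_at_remove g_compressing [set: B] b.
  have fiber_a : fiber f [set: A] alpha a by [].
  have fiber_b : fiber g [set: B] alpha b by [].
  rewrite fa in cA; rewrite gb in cB.
  (* All fibers of the whole posets are intact, so after the moves at [a] and [b] only the nimbers
     over [alpha] have to be compared. *)
  apply: matching_changes_at cA cB _ _ _.
  + by move=> beta; left.
  + exact: has_nimbers_remove nimbersA _.
  + exact: has_nimbers_remove nimbersB _.
  + rewrite fiber_remove; apply: has_nimbers_remove fiber_a.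
    exact: has_nimbers_fiber.
  + rewrite fiber_remove; apply: has_nimbers_remove fiber_b.
    exact: has_nimbers_fiber.
  + by rewrite !fiber_remove !fiberT.
Qed.
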